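(* Let $\beta>1$ and let $x=(x_n)_{n\ge1}\in \ell^2(\mathbb{R})$ with $x_n\ge 0$ for all $n\geq 1$. Then there exists a unique weak solution $X=(X_n)_{n\ge1}$ of the inviscid dyadic system $$\dot X_n = k_{n-1}X_{n-1}^2-k_nX_nX_{n+1},\qquad X_n(0)=x_n,\qquad n\ge1,\ t\ge0,$$ with initial condition $x$.
   Context: Conventions: $k_n=2^{\beta n}$ for $n\ge1$, $k_0=0$ and $X_0\equiv0$. A weak solution is a sequence $X=(X_n)_{n\ge1}$ of real-valued differentiable functions on $[0,\infty)$ satisfying the system (equations and initial conditions) for all $n\ge1$ and $t\ge0$. *)

(* Defs.v *)
From Stdlib Require Import Reals.
From Coquelicot Require Import Coquelicot.
Open Scope R_scope.

(** Sequences indexed by [n >= 1] are functions on [nat]; the value of the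
    initial datum at index [0] is never used. *)

Definition k (beta : R) (n : nat) : R :=
  match n with
  | O => 0
  | S _ => Rpower 2 (beta * INR n)
  end.

Definition in_l2 (x : nat -> R) : Prop :=
  ex_series (fun i : nat => x (S i) ^ 2).

(** Functions on [0, oo) are represented by functions on [R] whose values at
    negative times are irrelevant: [D_in] takes the limit of difference
    quotients inside the given domain, so at [t = 0] it is the right
    derivative. *)
Definition weak_solution (beta : R) (x : nat -> R) (X : nat -> R -> R) : Prop :=
  (forall t : R, 0 <= t -> X O t = 0) /\
  forall n : nat, (1 <= n)%nat ->
    X n 0 = x n /\
    forall t : R, 0 <= t ->
      D_in (X n)
           (fun s : R => k beta (n - 1) * X (n - 1)%nat s ^ 2
                         - k beta n * X n s * X (n + 1)%nat s)
           (fun s : R => 0 <= s) t.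

(* Main.v *)
Require Import Defs.
From Stdlib Require Import Reals Arith ZArith Lra Lia.
From Coquelicot Require Import Coquelicot.
From mathcomp Require filter.
Open Scope R_scope.

(** Uniqueness rests on nonnegativity.  The equation for [X_n] is linear in
    [X_n] with nonnegative source, so a solution with nonnegative data stays
    nonnegative ([flow_ge_0]); then the energy of the first [N] modes, whose
    derivative is [- 2 k_N X_N^2 X_(N+1)], decreases ([energy_bound]).  Hence
    every weak solution is bounded in [l^2] and has
    [2 int k_n X_n^2 X_(n+1) <= |x|^2].

    This controls only a mixed product, while the uniqueness argument needs the
    pure cubes [int k_n X_n^3].  They appear in the derivative of
    [X_n X_(n+1)]; the other terms there are split by Young's inequality into
    dissipation and small multiples of the cubes of modes [n], [n+1] and [n+2].
    So [B_n = int k_n X_n^3] satisfies [B_n <= C + eps (B_(n+1) + B_(n+2))] with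
    [eps] small ([cube_recursion]).  Since [B_n] grows at most like
    [2^(beta n)], iterating towards high modes bounds it uniformly in [n]
    ([absorb_tail], [cube_bound]).

    For two solutions with [Z = X - Y], consider
    [psi_N = sum_(n <= N) 2^(-n) Z_n^2].  With precisely the weights [2^(-n)]
    the interactions between neighbouring modes telescope; what is left is
    nonpositive except for one boundary term, whose time integral is at most
    [2^(-N)] times the bounded quantities [B_N] and [B_(N+1)] of the two
    solutions.  Therefore [psi_N(t) <= C 2^(-N)]
    ([weighted_distance_le]), and [N -> oo] gives [Z = 0] ([flow_unique]).

    For existence, the explicit Euler scheme is run on the first [m] modes with
    a mesh so fine that the energy created by the discretisation stays below
    [1] up to time [m] ([euler_energy]).  The bounds on each mode are then
    uniform in [m], and so is the first-order Taylor estimate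
    [|X_n(t) - X_n(s) - (t - s) f_n(X(s))| <= K_n (t - s)^2].  An ultrafilter
    on the indices [m] gives simultaneous limits of all modes at all times, and
    this estimate, which involves finitely many values, passes to the limit and
    says that the limit is differentiable with the right derivative
    ([solution_exists]).  This replaces an extraction of subsequences. *)

(** * Evolving quantities and differential inequalities *)

(** Differentiability is asked only at positive times, so that a function on
    [[0, oo)] can be extended by its initial value to negative times without
    caring about the corner at [0]; continuity everywhere makes the mean value
    theorem and the integrals from [0] available. *)
Definition evolves (f df : R -> R) : Prop :=
  (forall t, continuous f t) /\ forall t, 0 < t -> is_derive f t (df t).

Lemma evolves_nonincreasing (f df : R -> R) :
  evolves f df -> (forall t, 0 < t -> df t <= 0) ->
  forall t, 0 <= t -> f t <= f 0.
Proof.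
  intros [Hc Hd] Hle t Ht.
  destruct (Req_dec t 0) as [->|Hne]; [lra|].
  (* The mean value theorem may return an endpoint, where [df] is unknown, so
     it is applied with the derivative truncated to be nonpositive. *)
  destruct (MVT_gen f 0 t (fun s => Rmin (df s) 0)) as [c [_ Hc']].
  - intros s Hs. rewrite Rmin_left in Hs by lra.
    rewrite Rmin_left by (apply Hle; lra). apply Hd; lra.
  - intros s _. apply continuity_pt_filterlim, Hc.
  - assert (Rmin (df c) 0 <= 0) by apply Rmin_r. nra.
Qed.

Lemma evolves_const (c : R) : evolves (fun _ => c) (fun _ => 0).
Proof.
  split; intros; [apply continuous_const | exact (is_derive_const c t)].
Qed.

Lemma evolves_plus (f g df dg : R -> R) : evolves f df -> evolves g dg ->
  evolves (fun t => f t + g t) (fun t => df t + dg t).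
Proof.
  intros [Hf Hf'] [Hg Hg']; split; intros.
  - exact (continuous_plus f g t (Hf t) (Hg t)).
  - exact (is_derive_plus f g t _ _ (Hf' t H) (Hg' t H)).
Qed.

Lemma evolves_scal (c : R) (f df : R -> R) : evolves f df ->
  evolves (fun t => c * f t) (fun t => c * df t).
Proof.
  intros [Hf Hf']; split; intros.
  - exact (continuous_scal_r c f t (Hf t)).
  - exact (is_derive_scal f t c _ (Hf' t H)).
Qed.

Lemma evolves_mult (f g df dg : R -> R) : evolves f df -> evolves g dg ->
  evolves (fun t => f t * g t) (fun t => df t * g t + f t * dg t).
Proof.
  intros [Hf Hf'] [Hg Hg']; split; intros.
  - exact (continuous_mult f g t (Hf t) (Hg t)).
  - exact (is_derive_mult f g t _ _ (Hf' t H) (Hg' t H) Rmult_comm).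
Qed.

Lemma evolves_sum (f df : nat -> R -> R) (N : nat) :
  (forall n, evolves (f n) (df n)) ->
  evolves (fun t => sum_f_R0 (fun n => f n t) N)
          (fun t => sum_f_R0 (fun n => df n t) N).
Proof.
  intros H; induction N as [|N IH]; simpl; [apply H|].
  apply evolves_plus; auto.
Qed.

Lemma evolves_RInt (g : R -> R) : (forall t, continuous g t) ->
  evolves (fun t => RInt g 0 t) g.
Proof.
  intros Hg.
  assert (D : forall t, is_derive (fun t => RInt g 0 t) t (g t)).
  { intros t. apply (is_derive_RInt g _ 0); [|apply Hg].
    apply filter_forall; intros b.
    apply (RInt_correct g), (ex_RInt_continuous g); intros; apply Hg. }
  split; intros t; [|intros _; apply D].
  apply (ex_derive_continuous (fun t => RInt g 0 t)). eexists; apply D.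
Qed.

Lemma evolves_exp (f df : R -> R) : evolves f df ->
  evolves (fun t => exp (f t)) (fun t => df t * exp (f t)).
Proof.
  intros [Hf Hf']; split; intros.
  - apply (continuous_comp f exp); [apply Hf|].
    apply continuity_pt_filterlim, derivable_continuous_pt, derivable_pt_exp.
  - apply (is_derive_comp exp f); [apply is_derive_exp | apply Hf', H].
Qed.

(** * The dyadic flow: positivity and energy *)

(** Indexing by the constructor of [n] avoids truncated predecessors; at [0] the
    value [0] encodes [X_0 = 0]. *)
Definition flux (beta : R) (v : nat -> R) (n : nat) : R :=
  match n with
  | O => 0
  | S p => k beta p * v p ^ 2 - k beta n * v n * v (S n)
  end.

Definition flow (beta : R) (X : nat -> R -> R) : Prop :=
  (forall t, X O t = 0) /\
  forall n, evolves (X n) (fun t => flux beta (fun i => X i t) n).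

Lemma k_succ (beta : R) (n : nat) :
  (1 <= n)%nat -> k beta (S n) = Rpower 2 beta * k beta n.
Proof.
  intros H; destruct n as [|n]; [lia|].
  unfold k. rewrite <- Rpower_plus, (S_INR (S n)). f_equal; ring.
Qed.

Lemma k_ge_0 (beta : R) (n : nat) : 0 <= k beta n.
Proof. destruct n; simpl; [lra | left; apply exp_pos]. Qed.

Lemma k_le_pow (beta : R) (n : nat) : k beta n <= Rpower 2 beta ^ n.
Proof.
  assert (HL : 0 < Rpower 2 beta) by apply exp_pos.
  induction n as [|[|n] IH].
  - simpl; lra.
  - simpl. rewrite !Rmult_1_r. lra.
  - rewrite k_succ by lia. simpl in *. nra.
Qed.

Lemma base_ge_1 (beta : R) : 1 < beta -> 1 <= Rpower 2 beta.
Proof.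
  intros H. rewrite <- (Rpower_O 2) by lra. apply Rle_Rpower; lra.
Qed.

Lemma k_mono (beta : R) (n : nat) : 1 < beta -> k beta n <= k beta (S n).
Proof.
  intros H; pose proof (base_ge_1 beta H); pose proof (k_ge_0 beta n).
  destruct n; [apply k_ge_0|]. rewrite (k_succ beta (S n)) by lia. nra.
Qed.

(** [X_n' = a - c X_n] with [a >= 0]: multiplying by the integrating factor
    [exp (int c)] leaves a nondecreasing function.  The coupling to [X_(n+1)]
    sits in [c] alone, so each mode is treated on its own. *)
Lemma flow_ge_0 (beta : R) (X : nat -> R -> R) : flow beta X ->
  (forall n, 0 <= X n 0) -> forall n t, 0 <= t -> 0 <= X n t.
Proof.
  intros [H0 HX] Hi [|n] t Ht; [rewrite H0; lra|].
  set (rate := fun s => k beta (S n) * X (S (S n)) s).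
  assert (Hr : evolves (fun t => RInt rate 0 t) rate).
  { apply evolves_RInt. intros s. apply (evolves_scal _ _ _ (HX (S (S n)))). }
  apply evolves_exp in Hr.
  pose proof (evolves_scal (-1) _ _ (evolves_mult _ _ _ _ (HX (S n)) Hr)) as M.
  apply evolves_nonincreasing with (t := t) in M; [|clear M|exact Ht].
  - pose proof (exp_pos (RInt rate 0 t)).
    pose proof (exp_pos (RInt rate 0 0)).
    pose proof (Hi (S n)). nra.
  - intros s Hs. unfold flux, rate at 2.
    assert (0 <= k beta n * X n s ^ 2 * exp (RInt rate 0 s)); [|lra].
    apply Rmult_le_pos; [|left; apply exp_pos].
    apply Rmult_le_pos; [apply k_ge_0|apply pow2_ge_0].
Qed.

(** The transfer from mode [n] to mode [n + 1] cancels between the two modes, so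
    only the outflow from the last mode remains. *)
Lemma energy_flux (beta : R) (v : nat -> R) (N : nat) :
  sum_f_R0 (fun n => v n * flux beta v n) N
  = - (k beta N * v N ^ 2 * v (S N)).
Proof.
  induction N as [|N IH]; [simpl; ring|].
  rewrite tech5, IH. unfold flux. ring.
Qed.

Definition energy (X : nat -> R -> R) (N : nat) (t : R) : R :=
  sum_f_R0 (fun n => X n t ^ 2) N.

Lemma energy_evolves (beta : R) (X : nat -> R -> R) (N : nat) : flow beta X ->
  evolves (energy X N) (fun t => -2 * (k beta N * X N t ^ 2 * X (S N) t)).
Proof.
  intros [_ HX].
  assert (E : evolves (energy X N) (fun t => sum_f_R0 (fun n =>
     flux beta (fun i => X i t) n * (X n t * 1) +
     X n t * (flux beta (fun i => X i t) n * 1 + X n t * 0)) N)).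
  { apply (evolves_sum (fun n t => X n t ^ 2)). intros n. simpl.
    apply evolves_mult; [apply HX|].
    apply evolves_mult; [apply HX|apply evolves_const]. }
  destruct E as [Ec Ed]; split; [exact Ec|]. intros t Ht.
  specialize (Ed t Ht).
  replace (-2 * (k beta N * X N t ^ 2 * X (S N) t)) with
    (2 * sum_f_R0 (fun n => X n t * flux beta (fun i => X i t) n) N)
    by (rewrite energy_flux; ring).
  rewrite scal_sum.
  erewrite sum_eq in Ed; [exact Ed|]. intros i _; cbv beta; ring.
Qed.

Lemma energy_bound (beta : R) (X : nat -> R -> R) (N : nat) : flow beta X ->
  (forall n, 0 <= X n 0) -> forall t, 0 <= t -> energy X N t <= energy X N 0.
Proof.
  intros HX Hi.
  apply (evolves_nonincreasing _ _ (energy_evolves beta X N HX)).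
  intros t Ht.
  pose proof (k_ge_0 beta N).
  pose proof (flow_ge_0 _ _ HX Hi (S N) t ltac:(lra)).
  assert (0 <= k beta N * X N t ^ 2 * X (S N) t); [|lra].
  apply Rmult_le_pos; [|lra]. apply Rmult_le_pos; [lra|nra].
Qed.

Lemma term_le_sum (u : nat -> R) (n N : nat) : (forall i, 0 <= u i) ->
  (n <= N)%nat -> u n <= sum_f_R0 u N.
Proof.
  intros Hu. induction N as [|N IH]; intros H.
  - replace n with O by lia. simpl; lra.
  - rewrite tech5. destruct (Nat.eq_dec n (S N)) as [->|].
    + pose proof (cond_pos_sum u N Hu). lra.
    + pose proof (Hu (S N)). specialize (IH ltac:(lia)). lra.
Qed.

(** * A uniform bound on the integrated cubes *)

Lemma sq_mul_le_cubes (a b : R) : 0 <= a -> 0 <= b ->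
  a ^ 2 * b <= a ^ 3 + b ^ 3.
Proof.
  intros Ha Hb. pose proof (pow_le a 3 Ha). pose proof (pow_le b 3 Hb).
  destruct (Rle_dec a b).
  - assert (a ^ 2 * b <= b ^ 2 * b) by (apply Rmult_le_compat_r; nra).
    simpl in *; lra.
  - assert (a ^ 2 * b <= a ^ 2 * a) by (apply Rmult_le_compat_l; nra).
    simpl in *; lra.
Qed.

(** The error terms of [(X_n X_(n+1))'], for [a, b, c] the modes [n], [n+1],
    [n+2].  Young's inequality writes [a b^2] through [a^2 b] and [b^3], and
    [a b c] through [b^2 c] and [a^2 c].  The parameter is tuned to
    [D = 1 + L], which is large enough for the cubes to be absorbed in
    [cube_recursion] and [cube_bound]. *)
Lemma cube_domination (L a b c : R) : 1 <= L -> 0 <= a -> 0 <= b -> 0 <= c ->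
  L * a * b * c + a * b ^ 2 <=
  (1 + L) * (a ^ 2 * b) + L * (1 + L) * (b ^ 2 * c)
  + (b ^ 3 + L * a ^ 3 + L * c ^ 3) / (4 * (1 + L)).
Proof.
  intros HL Ha Hb Hc. set (D := 1 + L). assert (HD : 2 <= D) by (unfold D; lra).
  assert (I : forall p q, p * q <= D * p ^ 2 + q ^ 2 / (4 * D)).
  { intros p q. assert (0 <= (2 * D * p - q) ^ 2 / (4 * D)).
    { apply Rmult_le_pos; [apply pow2_ge_0|]. left; apply Rinv_0_lt_compat; lra. }
    replace (D * p ^ 2 + q ^ 2 / (4 * D)) with
      (p * q + (2 * D * p - q) ^ 2 / (4 * D)) by (field; lra). lra. }
  pose proof (I a b) as I1. pose proof (I b a) as I2.
  assert (J1 : a * b * b <= (D * a ^ 2 + b ^ 2 / (4 * D)) * b).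
  { apply Rmult_le_compat_r; lra. }
  assert (J2 : b * a * (L * c) <= (D * b ^ 2 + a ^ 2 / (4 * D)) * (L * c)).
  { apply Rmult_le_compat_r; nra. }
  pose proof (sq_mul_le_cubes a c Ha Hc) as Y.
  assert (Y' : L / (4 * D) * (a ^ 2 * c) <= L / (4 * D) * (a ^ 3 + c ^ 3)).
  { apply Rmult_le_compat_l; [|lra]. apply Rmult_le_pos; [lra|].
    left; apply Rinv_0_lt_compat; lra. }
  unfold Rdiv in *. set (w := / (4 * D)) in *. clearbody w.
  nra.
Qed.

Definition cube_int (X : nat -> R -> R) (n : nat) (t : R) : R :=
  RInt (fun s => X n s ^ 3) 0 t.

Lemma cube_int_evolves (beta : R) (X : nat -> R -> R) (n : nat) : flow beta X ->
  evolves (cube_int X n) (fun s => X n s ^ 3).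
Proof.
  intros [_ HX]. apply evolves_RInt. intros s. simpl.
  apply (continuous_mult (X n)); [apply HX|].
  apply (continuous_mult (X n)); [apply HX|].
  apply (continuous_mult (X n)); [apply HX|apply continuous_const].
Qed.

Lemma cube_int_0 (X : nat -> R -> R) (n : nat) : cube_int X n 0 = 0.
Proof. exact (RInt_point 0 (fun s => X n s ^ 3)). Qed.

Lemma energy_ge_0 (X : nat -> R -> R) (N : nat) (t : R) : 0 <= energy X N t.
Proof. apply cond_pos_sum; intros; apply pow2_ge_0. Qed.

Lemma flow_le_energy (beta : R) (X : nat -> R -> R) (E : R) : flow beta X ->
  (forall n, 0 <= X n 0) -> (forall N, energy X N 0 <= E) ->
  forall n t, 0 <= t -> X n t ^ 2 <= E.
Proof.
  intros HX Hi HE n t Ht.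
  apply Rle_trans with (energy X n t).
  - apply (term_le_sum (fun n => X n t ^ 2)); [|lia].
    intros; apply pow2_ge_0.
  - apply Rle_trans with (energy X n 0); [eapply energy_bound; eauto|apply HE].
Qed.

(** Crude but uniform in [n]: multiplied by [k_n] it grows geometrically, which
    is the a priori growth that [absorb_tail] can beat. *)
Lemma cube_int_growth (beta : R) (X : nat -> R -> R) (E : R) : flow beta X ->
  (forall n, 0 <= X n 0) -> (forall N, energy X N 0 <= E) ->
  forall n t, 0 <= t -> cube_int X n t <= (1 + E) ^ 3 * t.
Proof.
  intros HX Hi HE n t Ht.
  assert (HE0 : 0 <= E) by (eapply Rle_trans; [apply (energy_ge_0 X 0 0)|auto]).
  assert (Hl : evolves (fun t => RInt (fun _ => (1 + E) ^ 3) 0 t)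
                       (fun _ => (1 + E) ^ 3)).
  { apply evolves_RInt. intros; apply continuous_const. }
  pose proof (evolves_plus _ _ _ _
    (cube_int_evolves beta X n HX) (evolves_scal (-1) _ _ Hl)) as M.
  apply evolves_nonincreasing with (t := t) in M; [|clear M|exact Ht].
  - rewrite cube_int_0, !RInt_const in M. unfold scal in M; simpl in M.
    unfold mult in M; simpl in M. simpl. lra.
  - intros s Hs.
    assert (0 <= X n s <= 1 + E).
    { pose proof (flow_ge_0 _ _ HX Hi n s ltac:(lra)).
      pose proof (flow_le_energy _ _ _ HX Hi HE n s ltac:(lra)). nra. }
    pose proof (pow_incr _ _ 3 H). simpl in *; lra.
Qed.

Lemma cube_int_ge_0 (beta : R) (X : nat -> R -> R) : flow beta X ->
  (forall n, 0 <= X n 0) -> forall n t, 0 <= t -> 0 <= cube_int X n t.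
Proof.
  intros HX Hi n t Ht.
  pose proof (evolves_scal (-1) _ _ (cube_int_evolves beta X n HX)) as M.
  apply evolves_nonincreasing with (t := t) in M; [|clear M|exact Ht].
  - rewrite cube_int_0 in M. lra.
  - intros s Hs.
    pose proof (pow_le _ 3 (flow_ge_0 _ _ HX Hi n s ltac:(lra))). lra.
Qed.

(** Integrates [cube_domination] along the flow.  The dissipations
    [k_n X_n^2 X_(n+1)] and [k_(n+1) X_(n+1)^2 X_(n+2)] are the derivatives of
    [- energy / 2], so the whole inequality says that one explicit combination
    of cubes, energies and [X_n X_(n+1)] is nonincreasing. *)
Lemma cube_recursion (beta : R) (X : nat -> R -> R) (E : R) :
  1 < beta -> flow beta X ->
  (forall n, 0 <= X n 0) -> (forall N, energy X N 0 <= E) ->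
  forall n t, (1 <= n)%nat -> 0 <= t ->
  let L := Rpower 2 beta in
  let B := fun n => k beta n * cube_int X n t in
  B n <= 2 * E * (2 + L) + / (2 * (1 + L) * L) * (B (S n) + B (S (S n))).
Proof.
  intros Hb HX Hi HE n t Hn Ht L B.
  pose proof (base_ge_1 beta Hb) as HL. fold L in HL.
  set (w := / (4 * (1 + L))).
  assert (Hw : 0 < w) by (apply Rinv_0_lt_compat; lra).
  assert (Hw4 : 4 * (1 + L) * w = 1) by (unfold w; field; lra).
  assert (Hk1 : k beta (S n) = L * k beta n) by (apply k_succ; lia).
  assert (Hk2 : k beta (S (S n)) = L * (L * k beta n)).
  { rewrite k_succ, Hk1 by lia. reflexivity. }
  pose proof (k_ge_0 beta n) as Hk0.
  pose proof HX as HX'. destruct HX' as [_ HV].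
  (* The combination that decreases; [w] is the Young factor [1 / (4 D)], and
     [k_(n+1) = L k_n] lets all cubes be counted in units of [k_n]. *)
  pose proof (evolves_plus _ _ _ _
    (evolves_plus _ _ _ _
      (evolves_scal (k beta n) _ _ (cube_int_evolves beta X n HX))
      (evolves_scal (-1) _ _ (evolves_mult _ _ _ _ (HV n) (HV (S n)))))
    (evolves_plus _ _ _ _
      (evolves_scal ((1 + L) / 2) _ _ (evolves_plus _ _ _ _
        (energy_evolves beta X n HX) (energy_evolves beta X (S n) HX)))
      (evolves_scal (- w * k beta n) _ _ (evolves_plus _ _ _ _
        (cube_int_evolves beta X (S n) HX)
        (evolves_scal L _ _ (evolves_plus _ _ _ _
           (cube_int_evolves beta X n HX)
           (cube_int_evolves beta X (S (S n)) HX))))))) as M.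
  apply evolves_nonincreasing with (t := t) in M; [|clear M|exact Ht].
  - rewrite !cube_int_0 in M.
    pose proof (energy_ge_0 X n t). pose proof (energy_ge_0 X (S n) t).
    pose proof (HE n). pose proof (HE (S n)).
    pose proof (flow_le_energy _ _ _ HX Hi HE n t Ht).
    pose proof (flow_le_energy _ _ _ HX Hi HE (S n) t Ht).
    assert (X n t * X (S n) t <= E).
    { pose proof (pow2_ge_0 (X n t - X (S n) t)). nra. }
    assert (0 <= X n 0 * X (S n) 0) by (apply Rmult_le_pos; auto).
    assert (Hen : (1 + L) / 2 * (energy X n 0 + energy X (S n) 0)
                  <= (1 + L) / 2 * (E + E)).
    { apply Rmult_le_compat_l; lra. }
    assert (Hen' : 0 <= (1 + L) / 2 * (energy X n t + energy X (S n) t)).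
    { apply Rmult_le_pos; lra. }
    assert (HB1 : k beta n * cube_int X (S n) t = B (S n) * / L).
    { unfold B; rewrite Hk1; field; lra. }
    assert (HB2 : k beta n * (L * cube_int X (S (S n)) t) = B (S (S n)) * / L).
    { unfold B; rewrite Hk2; field; lra. }
    replace (/ (2 * (1 + L) * L)) with (2 * w * / L)
      by (unfold w; field; lra).
    assert (HBn : 0 <= B n).
    { apply Rmult_le_pos; [exact Hk0|]. eapply cube_int_ge_0; eauto. }
    assert (HwL : w * L <= 1 / 2) by nra.
    assert (w * L * B n <= 1 / 2 * B n) by (apply Rmult_le_compat_r; lra).
    assert (HM : B n <= E + (1 + L) * E
        + w * (B (S n) * / L + L * B n + B (S (S n)) * / L)).
    { rewrite <- HB1, <- HB2. unfold B at 1 2. nra. }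
    nra.
  - intros s Hs.
    pose proof (flow_ge_0 _ _ HX Hi n s ltac:(lra)) as Ha.
    pose proof (flow_ge_0 _ _ HX Hi (S n) s ltac:(lra)) as Hb'.
    pose proof (flow_ge_0 _ _ HX Hi (S (S n)) s ltac:(lra)) as Hc.
    assert (Hp : 0 <= k beta (n - 1) * X (n - 1)%nat s ^ 2 * X (S n) s).
    { apply Rmult_le_pos; [|lra].
      apply Rmult_le_pos; [apply k_ge_0|apply pow2_ge_0]. }
    assert (Hf : flux beta (fun i => X i s) n =
       k beta (n - 1) * X (n - 1)%nat s ^ 2 - k beta n * X n s * X (S n) s).
    { destruct n as [|p]; [lia|]. unfold flux. simpl Nat.sub.
      rewrite Nat.sub_0_r. reflexivity. }
    assert (Hf' : flux beta (fun i => X i s) (S n) =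
       k beta n * X n s ^ 2 - L * k beta n * X (S n) s * X (S (S n)) s).
    { unfold flux. rewrite Hk1. reflexivity. }
    rewrite Hf, Hf', Hk1.
    pose proof (cube_domination L _ _ _ HL Ha Hb' Hc) as D.
    unfold Rdiv at 1 in D. fold w in D.
    apply (Rmult_le_compat_l (k beta n)) in D; [|exact Hk0].
    nra.
Qed.

(** Each use of the recursion moves the unknown part to higher indices, where
    the geometric growth costs at most [L + L^2]; the factor [eps] pays for
    it and still gains [1 / 2]. *)
Lemma absorb_tail (B : nat -> R) (C K L eps : R) :
  0 <= C -> 0 <= K -> 1 <= L -> 0 <= eps ->
  4 * eps <= 1 -> eps * (L + L ^ 2) <= 1 / 2 ->
  (forall n, (1 <= n)%nat -> B n <= C + eps * (B (S n) + B (S (S n)))) ->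
  (forall n, (1 <= n)%nat -> B n <= K * L ^ n) ->
  forall n, (1 <= n)%nat -> B n <= 2 * C.
Proof.
  intros HC HK HL He He4 Hq Hrec Hgrow.
  assert (I : forall j n, (1 <= n)%nat ->
    B n <= 2 * C + (1 / 2) ^ j * (K * L ^ n)).
  { induction j as [|j IH]; intros n Hn.
    - specialize (Hgrow n Hn). rewrite pow_O. lra.
    - eapply Rle_trans; [apply Hrec, Hn|].
      pose proof (IH (S n) ltac:(lia)). pose proof (IH (S (S n)) ltac:(lia)).
      set (y := (1 / 2) ^ j * (K * L ^ n)) in *.
      assert (0 <= y).
      { apply Rmult_le_pos; [apply pow_le; lra|].
        apply Rmult_le_pos; [lra|apply pow_le; lra]. }
      replace ((1 / 2) ^ j * (K * L ^ S n)) with (L * y) in *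
        by (unfold y; simpl; ring).
      replace ((1 / 2) ^ j * (K * L ^ S (S n))) with (L ^ 2 * y) in *
        by (unfold y; simpl; ring).
      replace ((1 / 2) ^ S j * (K * L ^ n)) with (1 / 2 * y)
        by (unfold y; simpl; ring).
      assert (eps * (B (S n) + B (S (S n))) <=
              eps * (2 * C + L * y + (2 * C + L ^ 2 * y)))
        by (apply Rmult_le_compat_l; lra).
      assert (eps * (L + L ^ 2) * y <= 1 / 2 * y)
        by (apply Rmult_le_compat_r; lra).
      nra. }
  intros n Hn. apply le_epsilon. intros e Hpos.
  assert (HK' : 0 < K * L ^ n + 1).
  { assert (0 <= K * L ^ n) by (apply Rmult_le_pos; [lra|apply pow_le; lra]).
    lra. }
  destruct (pow_lt_1_zero (1 / 2) ltac:(rewrite Rabs_pos_eq; lra)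
    (e / (K * L ^ n + 1)) ltac:(apply Rdiv_lt_0_compat; lra)) as [j Hj].
  specialize (Hj j (le_n j)). specialize (I j n Hn).
  assert (Hp : 0 <= (1 / 2) ^ j) by (apply pow_le; lra).
  rewrite Rabs_pos_eq in Hj by exact Hp.
  apply (Rmult_lt_compat_r (K * L ^ n + 1)) in Hj; [|exact HK'].
  unfold Rdiv at 2 in Hj. rewrite Rmult_assoc, Rinv_l, Rmult_1_r in Hj by lra.
  nra.
Qed.

Lemma cube_bound (beta : R) (X : nat -> R -> R) (E : R) :
  1 < beta -> flow beta X ->
  (forall n, 0 <= X n 0) -> (forall N, energy X N 0 <= E) ->
  forall n t, (1 <= n)%nat -> 0 <= t ->
  k beta n * cube_int X n t <= 4 * E * (2 + Rpower 2 beta).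
Proof.
  intros Hb HX Hi HE n t Hn Ht.
  pose proof (base_ge_1 beta Hb) as HL. set (L := Rpower 2 beta) in *.
  assert (HE0 : 0 <= E) by (eapply Rle_trans; [apply (energy_ge_0 X 0 0)|auto]).
  assert (HLi : 0 < / (2 * (1 + L) * L)) by (apply Rinv_0_lt_compat; nra).
  assert (HLe : / (2 * (1 + L) * L) * (2 * (1 + L) * L) = 1) by (field; lra).
  replace (4 * E * (2 + L)) with (2 * (2 * E * (2 + L))) by ring.
  apply (absorb_tail (fun n => k beta n * cube_int X n t) _
           ((1 + E) ^ 3 * t) L (/ (2 * (1 + L) * L))); auto.
  - apply Rmult_le_pos; lra.
  - apply Rmult_le_pos; [apply pow_le; lra|lra].
  - lra.
  - nra.
  - replace (/ (2 * (1 + L) * L) * (L + L ^ 2)) with (1 / 2) by (field; lra). lra.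
  - intros m Hm. apply cube_recursion; auto.
  - intros m Hm. rewrite (Rmult_comm _ (L ^ m)).
    pose proof (k_ge_0 beta m).
    apply Rle_trans with (k beta m * ((1 + E) ^ 3 * t)).
    + apply Rmult_le_compat_l; [auto|]. eapply cube_int_growth; eauto.
    + apply Rmult_le_compat_r; [|apply k_le_pow].
      apply Rmult_le_pos; [apply pow_le; lra|lra].
Qed.

(** * Uniqueness *)

(** The derivative of [sum_(n <= N) 2^(-n) (u_n - v_n)^2] along the flow.  With
    [z = u - v] and [w = u + v], the difference of [u_n u_(n+1)] and
    [v_n v_(n+1)] is [(z_n w_(n+1) + w_n z_(n+1)) / 2].  The second half,
    weighted by [2^(-n)], cancels the inflow to mode [n + 1], weighted by
    [2^(-n-1)]; the first half is a dissipation because [w >= 0]. *)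
Lemma weighted_difference_flux (beta : R) (u v : nat -> R) (N : nat) :
  (forall n, 0 <= u n) -> (forall n, 0 <= v n) ->
  sum_f_R0 (fun n => (1 / 2) ^ n *
    (2 * ((u n - v n) * (flux beta u n - flux beta v n)))) N
  <= - ((1 / 2) ^ N * k beta N * ((u N ^ 2 - v N ^ 2) * (u (S N) - v (S N)))).
Proof.
  intros Hu Hv. induction N as [|N IH]; [simpl; lra|].
  rewrite tech5. unfold flux at 3 4.
  replace ((1 / 2) ^ S N) with (1 / 2 * (1 / 2) ^ N) by (simpl; ring).
  set (p := (1 / 2) ^ N) in *.
  assert (0 <= p) by (apply pow_le; lra).
  assert (0 <= p * k beta (S N) * ((u (S N) - v (S N)) ^ 2
                                   * (u (S (S N)) + v (S (S N))))).
  { apply Rmult_le_pos; [apply Rmult_le_pos; [auto|apply k_ge_0]|].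
    pose proof (Hu (S (S N))); pose proof (Hv (S (S N))).
    apply Rmult_le_pos; [apply pow2_ge_0|lra]. }
  nra.
Qed.

(** The boundary term is bounded by the mixed products [X_N^2 Y_(N+1)] and
    [Y_N^2 X_(N+1)], and these by cubes of single modes of a single solution,
    for which [cube_bound] is available. *)
Lemma weighted_distance_le (beta : R) (X Y : nat -> R -> R) (N : nat) (t : R) :
  1 < beta -> flow beta X -> flow beta Y ->
  (forall n, 0 <= X n 0) -> (forall n, Y n 0 = X n 0) -> 0 <= t ->
  sum_f_R0 (fun n => (1 / 2) ^ n * (X n t - Y n t) ^ 2) N <=
  (1 / 2) ^ N * (k beta N * cube_int X N t + k beta (S N) * cube_int X (S N) t
               + k beta N * cube_int Y N t + k beta (S N) * cube_int Y (S N) t).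
Proof.
  intros Hb HX HY Hi HXY Ht.
  assert (Hi' : forall n, 0 <= Y n 0) by (intros; rewrite HXY; auto).
  pose proof (fun n => evolves_plus _ _ _ _ (proj2 HX n)
     (evolves_scal (-1) _ _ (proj2 HY n))) as HZ.
  pose proof (evolves_plus _ _ _ _
    (evolves_sum _ _ N (fun n => evolves_scal ((1 / 2) ^ n) _ _
      (evolves_mult _ _ _ _ (HZ n) (HZ n))))
    (evolves_scal (- (1 / 2) ^ N) _ _
      (evolves_plus _ _ _ _
        (evolves_scal (k beta N) _ _ (evolves_plus _ _ _ _
          (cube_int_evolves beta X N HX) (cube_int_evolves beta Y N HY)))
        (evolves_scal (k beta (S N)) _ _ (evolves_plus _ _ _ _
          (cube_int_evolves beta X (S N) HX)
          (cube_int_evolves beta Y (S N) HY)))))) as M.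
  apply evolves_nonincreasing with (t := t) in M; [|clear M|exact Ht].
  - rewrite !cube_int_0 in M.
    rewrite (sum_eq (fun n => (1 / 2) ^ n * (X n t - Y n t) ^ 2)
      (fun n => (1 / 2) ^ n * ((X n t + -1 * Y n t) * (X n t + -1 * Y n t))))
      by (intros; ring).
    rewrite (sum_eq (fun n => (1 / 2) ^ n *
      ((X n 0 + -1 * Y n 0) * (X n 0 + -1 * Y n 0))) (fun _ => 0)) in M
      by (intros; rewrite HXY; ring).
    rewrite sum_cte in M. nra.
  - intros s Hs.
    pose proof (fun n => flow_ge_0 _ _ HX Hi n s ltac:(lra)) as Pu.
    pose proof (fun n => flow_ge_0 _ _ HY Hi' n s ltac:(lra)) as Pv.
    pose proof (weighted_difference_flux beta (fun i => X i s) (fun i => Y i s)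
      N Pu Pv) as D. cbv beta in D.
    rewrite (sum_eq _ (fun n => (1 / 2) ^ n *
      (2 * ((X n s - Y n s) * (flux beta (fun i => X i s) n
                               - flux beta (fun i => Y i s) n)))))
      by (intros i _; cbv beta; ring).
    assert (Hp : 0 <= (1 / 2) ^ N) by (apply pow_le; lra).
    pose proof (k_ge_0 beta N) as Hk.
    pose proof (k_mono beta N Hb) as Hk'.
    pose proof (sq_mul_le_cubes _ _ (Pu N) (Pv (S N))) as S1.
    pose proof (sq_mul_le_cubes _ _ (Pv N) (Pu (S N))) as S2.
    assert (0 <= X N s ^ 2 * X (S N) s)
      by (apply Rmult_le_pos; [apply pow2_ge_0|auto]).
    assert (0 <= Y N s ^ 2 * Y (S N) s)
      by (apply Rmult_le_pos; [apply pow2_ge_0|auto]).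
    assert (S4 : - ((X N s ^ 2 - Y N s ^ 2) * (X (S N) s - Y (S N) s)) <=
      (X N s ^ 3 + Y N s ^ 3) + (X (S N) s ^ 3 + Y (S N) s ^ 3)) by lra.
    apply (Rmult_le_compat_l (k beta N)) in S4; [|exact Hk].
    assert (S5 : k beta N * (X (S N) s ^ 3 + Y (S N) s ^ 3) <=
                 k beta (S N) * (X (S N) s ^ 3 + Y (S N) s ^ 3)).
    { apply Rmult_le_compat_r; [|exact Hk'].
      pose proof (pow_le _ 3 (Pu (S N))). pose proof (pow_le _ 3 (Pv (S N))).
      lra. }
    assert (S6 : k beta N *
      - ((X N s ^ 2 - Y N s ^ 2) * (X (S N) s - Y (S N) s)) <=
      k beta N * (X N s ^ 3 + Y N s ^ 3)
      + k beta (S N) * (X (S N) s ^ 3 + Y (S N) s ^ 3)) by lra.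
    apply (Rmult_le_compat_l ((1 / 2) ^ N)) in S6; [|exact Hp].
    lra.
Qed.

Lemma flow_unique (beta : R) (X Y : nat -> R -> R) (E : R) :
  1 < beta -> flow beta X -> flow beta Y ->
  (forall n, 0 <= X n 0) -> (forall n, Y n 0 = X n 0) ->
  (forall N, energy X N 0 <= E) ->
  forall n t, 0 <= t -> Y n t = X n t.
Proof.
  intros Hb HX HY Hi HXY HE n t Ht.
  assert (Hi' : forall n, 0 <= Y n 0) by (intros; rewrite HXY; auto).
  assert (HE' : forall N, energy Y N 0 <= E).
  { intros N. unfold energy. erewrite sum_eq; [apply (HE N)|].
    intros i _; cbv beta. rewrite HXY; reflexivity. }
  set (C := 4 * (4 * E * (2 + Rpower 2 beta))).
  assert (B : forall N, (1 <= N)%nat -> (n <= N)%nat ->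
    (1 / 2) ^ n * (X n t - Y n t) ^ 2 <= (1 / 2) ^ N * C).
  { intros N H1 Hn.
    pose proof (fun m H => cube_bound beta X E Hb HX Hi HE m t H Ht) as CX.
    pose proof (fun m H => cube_bound beta Y E Hb HY Hi' HE' m t H Ht) as CY.
    eapply Rle_trans;
      [apply (term_le_sum (fun n => (1 / 2) ^ n * (X n t - Y n t) ^ 2) n N);
       [|exact Hn]|].
    { intros i. apply Rmult_le_pos; [apply pow_le; lra|apply pow2_ge_0]. }
    eapply Rle_trans; [eapply weighted_distance_le; eauto|].
    apply Rmult_le_compat_l; [apply pow_le; lra|].
    pose proof (CX N H1). pose proof (CX (S N) ltac:(lia)).
    pose proof (CY N H1). pose proof (CY (S N) ltac:(lia)).
    unfold C; lra. }
  assert (Z : (1 / 2) ^ n * (X n t - Y n t) ^ 2 <= 0).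
  { assert (LC : is_lim_seq (fun N => (1 / 2) ^ N * C) (0 * C)).
    { apply is_lim_seq_mult'; [|apply is_lim_seq_const].
      apply is_lim_seq_geom. rewrite Rabs_pos_eq; lra. }
    rewrite Rmult_0_l in LC.
    assert (EV : eventually (fun N =>
      (1 / 2) ^ n * (X n t - Y n t) ^ 2 <= (1 / 2) ^ N * C))
      by (exists (S n); intros N HN; apply B; lia).
    exact (is_lim_seq_le_loc _ _ _ _ EV (is_lim_seq_const _) LC). }
  assert (0 < (1 / 2) ^ n) by (apply pow_lt; lra).
  assert ((X n t - Y n t) ^ 2 <= 0)
    by (apply (Rmult_le_reg_l ((1 / 2) ^ n)); lra).
  assert (X n t - Y n t = 0); [|lra].
  apply Rsqr_0_uniq. unfold Rsqr. pose proof (pow2_ge_0 (X n t - Y n t)). nra.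
Qed.

(** * The explicit Euler scheme *)

Lemma Rabs_le_of_sq (y E : R) : 0 <= E -> y ^ 2 <= 1 + E -> Rabs y <= 1 + E.
Proof. intros HE Hy. apply Rabs_le. nra. Qed.

Definition start (x : nat -> R) (n : nat) : R :=
  match n with O => 0 | S _ => x n end.

(** [j] steps of size [h] for the modes up to [N]; the outflow of mode [N] is
    shut off because mode [N + 1] stays at [0]. *)
Fixpoint euler (beta : R) (x : nat -> R) (N : nat) (h : R) (j : nat)
  : nat -> R :=
  match j with
  | O => fun n => if (n <=? N)%nat then start x n else 0
  | S i => fun n => let v := euler beta x N h i in
           if (n <=? N)%nat then v n + h * flux beta v n else 0
  end.

Lemma euler_above (beta : R) (x : nat -> R) (N : nat) (h : R) (j n : nat) :
  (N < n)%nat -> euler beta x N h j n = 0.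
Proof.
  intros H. destruct j; simpl;
    (replace (n <=? N)%nat with false; [reflexivity|]);
    symmetry; apply Nat.leb_gt; exact H.
Qed.

Lemma euler_start (beta : R) (x : nat -> R) (N : nat) (h : R) (n : nat) :
  (n <= N)%nat -> euler beta x N h 0 n = start x n.
Proof. intros H. simpl. apply Nat.leb_le in H. rewrite H. reflexivity. Qed.

Lemma euler_step (beta : R) (x : nat -> R) (N : nat) (h : R) (j n : nat) :
  (n <= N)%nat -> euler beta x N h (S j) n =
  euler beta x N h j n + h * flux beta (euler beta x N h j) n.
Proof. intros H. simpl. apply Nat.leb_le in H. rewrite H. reflexivity. Qed.

Lemma euler_0 (beta : R) (x : nat -> R) (N : nat) (h : R) (j : nat) :
  euler beta x N h j O = 0.
Proof.
  induction j as [|j IH]; [rewrite euler_start by lia; reflexivity|].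
  rewrite euler_step, IH by lia. simpl; ring.
Qed.

(** Bounds the [n]-th component of the flux on states with all modes at most
    [r], hence also the Lipschitz constant of the [n]-th mode in time. *)
Definition speed (beta r : R) (n : nat) : R :=
  (k beta (pred n) + k beta n) * r ^ 2.

Lemma speed_ge_0 (beta r : R) (n : nat) : 0 <= speed beta r n.
Proof.
  pose proof (k_ge_0 beta (pred n)). pose proof (k_ge_0 beta n).
  apply Rmult_le_pos; [lra|apply pow2_ge_0].
Qed.

Lemma flux_le_speed (beta r : R) (v : nat -> R) (n : nat) :
  (forall i, Rabs (v i) <= r) -> Rabs (flux beta v n) <= speed beta r n.
Proof.
  intros Hv. destruct n as [|n].
  - simpl. rewrite Rabs_R0. apply speed_ge_0.
  - unfold flux, speed. simpl pred.
    pose proof (k_ge_0 beta n) as K1. pose proof (k_ge_0 beta (S n)) as K2.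
    eapply Rle_trans; [apply Rabs_triang|].
    rewrite Rabs_Ropp, !Rabs_mult, !(Rabs_pos_eq (k beta _)) by auto.
    rewrite <- RPow_abs.
    rewrite Rmult_plus_distr_r. apply Rplus_le_compat.
    + apply Rmult_le_compat_l; [auto|]. apply pow_incr. split; [|auto].
      apply Rabs_pos.
    + rewrite Rmult_assoc. apply Rmult_le_compat_l; [auto|].
      simpl; rewrite Rmult_1_r.
      apply Rmult_le_compat; auto; apply Rabs_pos.
Qed.

Definition step_cost (beta r : R) (N : nat) : R :=
  sum_f_R0 (fun n => speed beta r n ^ 2) N.

(** The truncated flux is orthogonal to the state, so a step creates energy only
    at second order in [h]. *)
Lemma euler_energy_step (beta : R) (x : nat -> R) (N : nat) (h : R) (j : nat) :
  sum_f_R0 (fun n => euler beta x N h (S j) n ^ 2) N =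
  sum_f_R0 (fun n => euler beta x N h j n ^ 2) N
  + h ^ 2 * sum_f_R0 (fun n => flux beta (euler beta x N h j) n ^ 2) N.
Proof.
  set (v := euler beta x N h j).
  pose proof (energy_flux beta v N) as Z.
  unfold v at 4 in Z. rewrite euler_above, Rmult_0_r, Ropp_0 in Z by lia.
  rewrite (sum_eq _ (fun n => v n ^ 2 + (v n * flux beta v n * (2 * h)
     + flux beta v n ^ 2 * h ^ 2))).
  - rewrite !plus_sum, <- !scal_sum, Z. ring.
  - intros i Hi. rewrite euler_step by lia. fold v. ring.
Qed.

(** A bootstrap: as long as the energy created is at most [1], the modes are
    bounded by [1 + E], which bounds the energy created in the next step.  The
    bound on the modes does not depend on [N]. *)
Lemma euler_energy (beta : R) (x : nat -> R) (N : nat) (h E : R) (j : nat) :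
  0 <= E -> sum_f_R0 (fun n => start x n ^ 2) N <= E ->
  INR j * (h ^ 2 * step_cost beta (1 + E) N) <= 1 ->
  sum_f_R0 (fun n => euler beta x N h j n ^ 2) N <=
    E + INR j * (h ^ 2 * step_cost beta (1 + E) N)
  /\ forall n, Rabs (euler beta x N h j n) <= 1 + E.
Proof.
  intros HE Hx. set (q := h ^ 2 * step_cost beta (1 + E) N).
  assert (Hq : 0 <= q).
  { apply Rmult_le_pos; [apply pow2_ge_0|].
    apply cond_pos_sum; intros; apply pow2_ge_0. }
  assert (P : forall i, INR i * q <= 1 ->
    sum_f_R0 (fun n => euler beta x N h i n ^ 2) N <= E + INR i * q ->
    forall n, Rabs (euler beta x N h i n) <= 1 + E).
  { intros i H1 H2 n. apply Rabs_le_of_sq; [exact HE|].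
    destruct (le_lt_dec n N) as [Hn|Hn].
    - pose proof (term_le_sum (fun n => euler beta x N h i n ^ 2) n N
        (fun _ => pow2_ge_0 _) Hn) as T. cbv beta in T. lra.
    - rewrite euler_above by exact Hn. simpl; lra. }
  intros Hj.
  assert (G : sum_f_R0 (fun n => euler beta x N h j n ^ 2) N
              <= E + INR j * q); [|split; auto].
  induction j as [|j IH].
  - rewrite (sum_eq _ (fun n => start x n ^ 2)); [change (INR 0) with 0; lra|].
    intros i Hi. rewrite euler_start by exact Hi. reflexivity.
  - rewrite S_INR in *. assert (Hj' : INR j * q <= 1) by lra.
    specialize (IH Hj'). pose proof (P j Hj' IH) as B.
    rewrite euler_energy_step.
    assert (sum_f_R0 (fun n => flux beta (euler beta x N h j) n ^ 2) N
            <= step_cost beta (1 + E) N).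
    { apply sum_Rle. intros n _. rewrite <- (pow2_abs (flux _ _ _)).
      apply pow_incr. split; [apply Rabs_pos|apply flux_le_speed, B]. }
    assert (h ^ 2 * sum_f_R0 (fun n => flux beta (euler beta x N h j) n ^ 2) N
            <= q) by (apply Rmult_le_compat_l; [apply pow2_ge_0|auto]).
    lra.
Qed.

Lemma euler_lipschitz (beta : R) (x : nat -> R) (N : nat) (h r : R)
  (i d n : nat) : 0 <= h ->
  (forall l, (l <= i + d)%nat -> forall m, Rabs (euler beta x N h l m) <= r) ->
  Rabs (euler beta x N h (i + d) n - euler beta x N h i n) <=
    speed beta r n * (h * INR d).
Proof.
  intros Hh. pose proof (speed_ge_0 beta r n) as Hs.
  induction d as [|d IH]; intros B.
  - rewrite Nat.add_0_r, Rminus_diag, Rabs_R0. simpl. nra.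
  - rewrite S_INR.
    specialize (IH (fun l Hl => B l ltac:(lia))).
    assert (Rabs (euler beta x N h (i + S d) n - euler beta x N h (i + d) n)
            <= speed beta r n * h).
    { destruct (le_lt_dec n N) as [Hn|Hn].
      - rewrite Nat.add_succ_r, euler_step by exact Hn.
        match goal with |- Rabs ?e <= _ =>
          replace e with (h * flux beta (euler beta x N h (i + d)) n) by ring
        end.
        rewrite Rabs_mult, Rabs_pos_eq, Rmult_comm by exact Hh.
        apply Rmult_le_compat_r; [exact Hh|].
        apply flux_le_speed, B; lia.
      - rewrite !euler_above by exact Hn. rewrite Rminus_diag, Rabs_R0. nra. }
    replace (euler beta x N h (i + S d) n - euler beta x N h i n) with
      ((euler beta x N h (i + S d) n - euler beta x N h (i + d) n)
       + (euler beta x N h (i + d) n - euler beta x N h i n)) by ring.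
    eapply Rle_trans; [apply Rabs_triang|]. lra.
Qed.

(** The Lipschitz constant in time of the [n]-th flux component when each mode
    [i] has Lipschitz constant [speed beta r i]; it does not see the number of
    modes of the scheme. *)
Definition flux_modulus (beta r : R) (n : nat) : R :=
  k beta (pred n) * (2 * r * speed beta r (pred n))
  + k beta n * (r * (speed beta r n + speed beta r (S n))).

Lemma flux_modulus_ge_0 (beta r : R) (n : nat) : 0 <= r ->
  0 <= flux_modulus beta r n.
Proof.
  intros Hr. pose proof (k_ge_0 beta (pred n)). pose proof (k_ge_0 beta n).
  pose proof (speed_ge_0 beta r (pred n)). pose proof (speed_ge_0 beta r n).
  pose proof (speed_ge_0 beta r (S n)).
  repeat first [assumption | lra | apply Rmult_le_pos
    | apply Rplus_le_le_0_compat].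
Qed.

Lemma flux_close (beta r e : R) (u v : nat -> R) (n : nat) :
  0 <= r -> 0 <= e ->
  (forall i, Rabs (u i) <= r) -> (forall i, Rabs (v i) <= r) ->
  (forall i, Rabs (u i - v i) <= speed beta r i * e) ->
  Rabs (flux beta u n - flux beta v n) <= flux_modulus beta r n * e.
Proof.
  intros Hr He Hu Hv Huv. destruct n as [|n].
  - unfold flux. rewrite Rminus_diag, Rabs_R0.
    apply Rmult_le_pos; [apply flux_modulus_ge_0|]; auto.
  - unfold flux, flux_modulus. simpl pred.
    replace (k beta n * u n ^ 2 - k beta (S n) * u (S n) * u (S (S n)) -
       (k beta n * v n ^ 2 - k beta (S n) * v (S n) * v (S (S n)))) with
      (k beta n * ((u n + v n) * (u n - v n))
       + - (k beta (S n) * ((u (S n) - v (S n)) * u (S (S n))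
                            + v (S n) * (u (S (S n)) - v (S (S n)))))) by ring.
    eapply Rle_trans; [apply Rabs_triang|].
    rewrite Rabs_Ropp, !Rabs_mult, !(Rabs_pos_eq (k beta _)) by apply k_ge_0.
    rewrite Rmult_plus_distr_r, !(Rmult_assoc (k beta _)).
    apply Rplus_le_compat; (apply Rmult_le_compat_l; [apply k_ge_0|]).
    + rewrite Rmult_assoc. apply Rmult_le_compat; auto; try apply Rabs_pos.
      eapply Rle_trans; [apply Rabs_triang|].
      pose proof (Hu n); pose proof (Hv n); lra.
    + eapply Rle_trans; [apply Rabs_triang|]. rewrite !Rabs_mult.
      replace (r * (speed beta r (S n) + speed beta r (S (S n))) * e) with
        (speed beta r (S n) * e * r + r * (speed beta r (S (S n)) * e)) by ring.
      apply Rplus_le_compat; apply Rmult_le_compat; auto; apply Rabs_pos.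
Qed.

Lemma euler_taylor (beta : R) (x : nat -> R) (N : nat) (h r : R)
  (i d n : nat) : 0 <= h -> 0 <= r -> (n <= N)%nat ->
  (forall l, (l <= i + d)%nat -> forall m, Rabs (euler beta x N h l m) <= r) ->
  Rabs (euler beta x N h (i + d) n - euler beta x N h i n
        - h * INR d * flux beta (euler beta x N h i) n) <=
    flux_modulus beta r n * (h * INR d) ^ 2.
Proof.
  intros Hh Hr Hn. pose proof (flux_modulus_ge_0 beta r n Hr) as Hs.
  induction d as [|d IH]; intros B.
  - rewrite Nat.add_0_r. simpl INR.
    match goal with |- Rabs ?e <= _ => replace e with 0 by ring end.
    rewrite Rabs_R0. simpl; nra.
  - specialize (IH (fun l Hl => B l ltac:(lia))).
    pose proof (pos_INR d) as Hd.
    assert (F : Rabs (flux beta (euler beta x N h (i + d)) n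
                      - flux beta (euler beta x N h i) n)
                <= flux_modulus beta r n * (h * INR d)).
    { apply flux_close; auto; try (intros; apply B; lia).
      - apply Rmult_le_pos; lra.
      - intros m. apply euler_lipschitz; [auto|]. intros; apply B; lia. }
    rewrite Nat.add_succ_r, euler_step, S_INR by exact Hn.
    set (F0 := flux beta (euler beta x N h i) n) in *.
    set (F1 := flux beta (euler beta x N h (i + d)) n) in *.
    set (v1 := euler beta x N h (i + d) n) in *.
    set (v0 := euler beta x N h i n) in *.
    replace (v1 + h * F1 - v0 - h * (INR d + 1) * F0) with
      ((v1 - v0 - h * INR d * F0) + h * (F1 - F0)) by ring.
    eapply Rle_trans; [apply Rabs_triang|].
    rewrite (Rabs_mult h), (Rabs_pos_eq h) by exact Hh.
    assert (h * Rabs (F1 - F0) <= h * (flux_modulus beta r n * (h * INR d)))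
      by (apply Rmult_le_compat_l; auto).
    set (M := flux_modulus beta r n) in *.
    assert (0 <= M * (h ^ 2 * (INR d + 1))).
    { apply Rmult_le_pos; [auto|]. apply Rmult_le_pos; [apply pow2_ge_0|lra]. }
    nra.
Qed.

(** The base point may lie after the other time: two-sided difference quotients
    at positive times are needed. *)
Lemma euler_taylor_two_sided (beta : R) (x : nat -> R) (N : nat) (h r : R)
  (i j n : nat) : 0 <= h -> 0 <= r -> (n <= N)%nat ->
  (forall l, (l <= i \/ l <= j)%nat ->
     forall m, Rabs (euler beta x N h l m) <= r) ->
  Rabs (euler beta x N h j n - euler beta x N h i n
        - (h * INR j - h * INR i) * flux beta (euler beta x N h i) n) <=
    2 * flux_modulus beta r n * (h * INR j - h * INR i) ^ 2.
Proof.
  intros Hh Hr Hn B. pose proof (flux_modulus_ge_0 beta r n Hr) as Hs.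
  destruct (le_lt_dec i j) as [Hij|Hij].
  - set (d := (j - i)%nat). replace j with (i + d)%nat in * by lia.
    rewrite plus_INR.
    replace (h * (INR i + INR d) - h * INR i) with (h * INR d) by ring.
    eapply Rle_trans; [apply euler_taylor with (r := r); auto|].
    pose proof (pow2_ge_0 (h * INR d)). nra.
  - set (d := (i - j)%nat). replace i with (j + d)%nat in * by lia.
    rewrite plus_INR.
    replace (h * INR j - h * (INR j + INR d)) with (- (h * INR d)) by ring.
    assert (T : Rabs (euler beta x N h (j + d) n - euler beta x N h j n
        - h * INR d * flux beta (euler beta x N h j) n) <=
        flux_modulus beta r n * (h * INR d) ^ 2)
      by (apply euler_taylor; auto).
    assert (F : Rabs (flux beta (euler beta x N h (j + d)) n
                      - flux beta (euler beta x N h j) n)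
                <= flux_modulus beta r n * (h * INR d)).
    { apply flux_close; auto; try (intros; apply B; lia).
      - apply Rmult_le_pos; [auto|apply pos_INR].
      - intros m. apply euler_lipschitz; auto. }
    set (F0 := flux beta (euler beta x N h j) n) in *.
    set (F1 := flux beta (euler beta x N h (j + d)) n) in *.
    set (v1 := euler beta x N h (j + d) n) in *.
    set (v0 := euler beta x N h j n) in *.
    set (y := h * INR d) in *.
    assert (Hy : 0 <= y) by (apply Rmult_le_pos; [auto|apply pos_INR]).
    replace (v0 - v1 - - y * F1) with
      (y * (F1 - F0) + - (v1 - v0 - y * F0)) by ring.
    eapply Rle_trans; [apply Rabs_triang|].
    rewrite Rabs_Ropp, Rabs_mult, (Rabs_pos_eq y) by exact Hy.
    assert (y * Rabs (F1 - F0) <= y * (flux_modulus beta r n * y))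
      by (apply Rmult_le_compat_l; auto).
    nra.
Qed.

(** * Limits along an ultrafilter *)

(** A nonprincipal ultrafilter on the natural numbers. *)
Definition ultra (U : (nat -> Prop) -> Prop) : Prop :=
  ProperFilter' U /\ (forall P, eventually P -> U P) /\
  forall P, U P \/ U (fun m => ~ P m).

Lemma ultra_exists : exists U, ultra U.
Proof.
  destruct (filter.ultraFilterLemma (T := nat) (F := eventually)) as [U [HU HE]].
  - split; [intros [N HN]; exact (HN N (le_n N))|]. split.
    + apply filter_true.
    + intros P Q; apply filter_and.
    + intros P Q; apply filter_imp.
  - pose proof (filter.ultra_proper (UltraFilter := HU)) as [Hne [HT HI HS]].
    exists U. split; [|split; [exact HE|]].
    + split; [exact Hne|]. split; [exact HT|exact HI|exact HS].
    + intros P. exact (filter.in_ultra_setVsetC P HU).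
Qed.

Definition ultralimit (U : (nat -> Prop) -> Prop) (u : nat -> R) : R :=
  real (Lub_Rbar (fun c => U (fun m => c <= u m))).

(** Every bounded sequence converges along an ultrafilter.  This gives limits at
    uncountably many times at once, without extracting subsequences. *)
Lemma ultralimit_correct (U : (nat -> Prop) -> Prop) (u : nat -> R) (r : R) :
  ultra U -> U (fun m => Rabs (u m) <= r) ->
  filterlim u U (locally (ultralimit U u)).
Proof.
  intros [HP [_ HD]] Hu. pose proof (filter_filter' (F := U)) as HF.
  unfold ultralimit. set (S := fun c => U (fun m => c <= u m)).
  destruct (Lub_Rbar_correct S) as [Hub Hl].
  assert (Hlo : S (- r)).
  { apply (filter_imp _ _ (fun m H => proj1 (Rabs_le_between _ _) H) ) in Hu.
    unfold S. revert Hu. apply filter_imp. intros m H; apply H. }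
  assert (Hup : is_ub_Rbar S r).
  { intros c Hc. simpl. destruct (Rle_dec c r) as [|Hn]; [auto|exfalso].
    apply (filter_not_empty (F := U)).
    generalize (filter_and _ _ Hc Hu). apply filter_imp. intros m [H1 H2].
    apply Rabs_le_between in H2. lra. }
  pose proof (Hub _ Hlo) as B1. pose proof (Hl _ Hup) as B2.
  destruct (Lub_Rbar S) as [l| |]; simpl in B1, B2 |- *; try easy.
  apply filterlim_locally. intros eps.
  assert (L1 : exists c, S c /\ l - eps < c).
  { apply Classical_Prop.NNPP. intros Hno.
    assert (HB : is_ub_Rbar S (l - eps)).
    { intros c Hc. simpl. destruct (Rle_dec c (l - eps)); [auto|].
      exfalso; apply Hno. exists c; split; [auto|lra]. }
    apply Hl in HB. simpl in HB. pose proof (cond_pos eps). lra. }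
  destruct L1 as [c [Hc Hcl]].
  assert (L2 : U (fun m => u m < l + eps)).
  { destruct (HD (fun m => l + eps <= u m)) as [H|H].
    - apply Hub in H. simpl in H. pose proof (cond_pos eps). lra.
    - revert H. apply filter_imp. intros m Hm; lra. }
  generalize (filter_and _ _ Hc L2). apply filter_imp. intros m [H1 H2].
  apply Rabs_lt_between'. lra.
Qed.

Lemma filterlim_R_plus (U : (nat -> Prop) -> Prop) (HU : Filter U)
  (u v : nat -> R) (a b : R) :
  filterlim u U (locally a) -> filterlim v U (locally b) ->
  filterlim (fun m => u m + v m) U (locally (a + b)).
Proof.
  intros Hu Hv. exact (filterlim_comp_2 _ _ _ Hu Hv (filterlim_plus a b)).
Qed.

Lemma filterlim_R_mult (U : (nat -> Prop) -> Prop) (HU : Filter U)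
  (u v : nat -> R) (a b : R) :
  filterlim u U (locally a) -> filterlim v U (locally b) ->
  filterlim (fun m => u m * v m) U (locally (a * b)).
Proof.
  intros Hu Hv. exact (filterlim_comp_2 _ _ _ Hu Hv (filterlim_mult a b)).
Qed.

Lemma filterlim_R_minus (U : (nat -> Prop) -> Prop) (HU : Filter U)
  (u v : nat -> R) (a b : R) :
  filterlim u U (locally a) -> filterlim v U (locally b) ->
  filterlim (fun m => u m - v m) U (locally (a - b)).
Proof.
  intros Hu Hv. apply filterlim_R_plus; auto.
  exact (filterlim_comp _ _ _ _ _ _ _ _ Hv (filterlim_opp b)).
Qed.

Lemma filterlim_flux (U : (nat -> Prop) -> Prop) (HU : Filter U) (beta : R)
  (u : nat -> nat -> R) (l : nat -> R) :
  (forall n, filterlim (fun m => u m n) U (locally (l n))) ->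
  forall n, filterlim (fun m => flux beta (u m) n) U (locally (flux beta l n)).
Proof.
  intros H [|n]; unfold flux; [apply filterlim_const|]. simpl pow.
  repeat first [ apply H | apply filterlim_const
    | apply filterlim_R_minus; auto | apply filterlim_R_mult; auto ].
Qed.

(** * Existence *)

(** The energy created up to time [m] is at most [m] times the mesh times
    [step_cost]; the mesh is chosen to keep it below [1] and to tend to [0]. *)
Definition mesh (beta E : R) (m : nat) : R :=
  / ((INR m + 1) * (1 + step_cost beta (1 + E) m)).

Definition steps (h t : R) : nat := Z.to_nat (Int_part (t / h)).

Lemma steps_spec (h t : R) : 0 < h -> 0 <= t ->
  t - h < h * INR (steps h t) <= t.
Proof.
  intros Hh Ht. unfold steps. destruct (base_Int_part (t / h)) as [H1 H2].
  assert (Hth : 0 <= t / h) by (apply Rdiv_le_0_compat; auto).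
  assert (Hz : (0 <= Int_part (t / h))%Z).
  { assert (-1 < Int_part (t / h))%Z by (apply lt_IZR; lra). lia. }
  rewrite INR_IZR_INZ, Z2Nat.id by exact Hz.
  assert (Et : t = h * (t / h)) by (field; lra).
  split; [|rewrite Et at 2]; nra.
Qed.

Lemma steps_0 (h : R) : 0 < h -> steps h 0 = O.
Proof.
  intros Hh. pose proof (steps_spec h 0 Hh (Rle_refl 0)) as [_ H].
  destruct (steps h 0); [reflexivity|].
  rewrite S_INR in H. pose proof (pos_INR n). nra.
Qed.

Lemma step_cost_ge_0 (beta r : R) (N : nat) : 0 <= step_cost beta r N.
Proof. apply cond_pos_sum; intros; apply pow2_ge_0. Qed.

Lemma mesh_spec (beta E : R) (m : nat) :
  0 < mesh beta E m <= / (INR m + 1) /\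
  INR m * (mesh beta E m * step_cost beta (1 + E) m) <= 1.
Proof.
  pose proof (step_cost_ge_0 beta (1 + E) m) as Hc. unfold mesh.
  set (c := step_cost beta (1 + E) m) in *. pose proof (pos_INR m) as Hm.
  assert (Hp : 0 < (INR m + 1) * (1 + c)) by (apply Rmult_lt_0_compat; lra).
  split; [split|].
  - apply Rinv_0_lt_compat, Hp.
  - apply Rinv_le_contravar; [lra|nra].
  - apply (Rmult_le_reg_l _ _ _ Hp).
    replace ((INR m + 1) * (1 + c) * (INR m * (/ ((INR m + 1) * (1 + c)) * c)))
      with (INR m * c) by (field; lra). nra.
Qed.

Definition approx (beta E : R) (x : nat -> R) (m n : nat) (t : R) : R :=
  euler beta x m (mesh beta E m) (steps (mesh beta E m) t) n.

Definition grid_time (beta E : R) (m : nat) (t : R) : R :=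
  mesh beta E m * INR (steps (mesh beta E m) t).

Lemma grid_time_lim (beta E t : R) : 0 <= t ->
  filterlim (fun m => grid_time beta E m t) eventually (locally t).
Proof.
  intros Ht.
  apply (is_lim_seq_le_le (fun m => t - / (INR m + 1)) _ (fun _ => t) t).
  - intros m. destruct (mesh_spec beta E m) as [[H1 H2] _].
    pose proof (steps_spec _ t H1 Ht). unfold grid_time. lra.
  - replace (Finite t) with (Finite (t - 0)) by (f_equal; ring).
    apply is_lim_seq_minus'; [apply is_lim_seq_const|].
    replace (Finite 0) with (Rbar_inv p_infty) by reflexivity.
    apply is_lim_seq_inv; [|easy].
    apply (is_lim_seq_ext (fun m => INR (S m))); [intros; apply S_INR|].
    apply (is_lim_seq_incr_1 INR), is_lim_seq_INR.
  - apply is_lim_seq_const.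
Qed.

Lemma eventually_above (t : R) : eventually (fun m => t <= INR m).
Proof.
  destruct (INR_unbounded t) as [N HN]. exists N. intros m Hm.
  apply le_INR in Hm. lra.
Qed.

Lemma approx_bound (beta E : R) (x : nat -> R) (m : nat) :
  0 <= E -> (forall N, sum_f_R0 (fun n => start x n ^ 2) N <= E) ->
  forall l, mesh beta E m * INR l <= INR m ->
  forall n, Rabs (euler beta x m (mesh beta E m) l n) <= 1 + E.
Proof.
  intros HE Hx l Hl. apply euler_energy; auto.
  destruct (mesh_spec beta E m) as [[H1 _] H2].
  pose proof (step_cost_ge_0 beta (1 + E) m).
  apply Rle_trans with (INR m * (mesh beta E m * step_cost beta (1 + E) m));
    [|exact H2].
  replace (INR l * (mesh beta E m ^ 2 * step_cost beta (1 + E) m)) with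
    (mesh beta E m * INR l * (mesh beta E m * step_cost beta (1 + E) m)) by ring.
  apply Rmult_le_compat_r; [apply Rmult_le_pos; lra|exact Hl].
Qed.

Lemma approx_taylor (beta E : R) (x : nat -> R) (m n : nat) (s t : R) :
  0 <= E -> (forall N, sum_f_R0 (fun n => start x n ^ 2) N <= E) ->
  (n <= m)%nat -> 0 <= s <= INR m -> 0 <= t <= INR m ->
  Rabs (approx beta E x m n t - approx beta E x m n s
        - (grid_time beta E m t - grid_time beta E m s)
          * flux beta (fun i => approx beta E x m i s) n) <=
  2 * flux_modulus beta (1 + E) n *
    (grid_time beta E m t - grid_time beta E m s) ^ 2.
Proof.
  intros HE Hx Hn Hs Ht. destruct (mesh_spec beta E m) as [[Hh _] _].
  apply (euler_taylor_two_sided beta x m (mesh beta E m) (1 + E)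
    (steps (mesh beta E m) s) (steps (mesh beta E m) t) n); [lra|lra|exact Hn|].
  intros l Hl. apply approx_bound; auto.
  pose proof (steps_spec _ s Hh (proj1 Hs)).
  pose proof (steps_spec _ t Hh (proj1 Ht)).
  destruct Hl as [Hl|Hl]; apply le_INR in Hl;
    apply (Rmult_le_compat_l (mesh beta E m)) in Hl; lra.
Qed.

(** A quadratic remainder makes the difference quotient converge; this is how
    the estimate for the scheme becomes a differential equation, with no
    integral equation in between. *)
Lemma D_in_of_taylor (f F : R -> R) (s K : R) :
  (forall t, 0 <= t -> Rabs (f t - f s - (t - s) * F s) <= K * (t - s) ^ 2) ->
  D_in f F (fun t => 0 <= t) s.
Proof.
  intros H eps Heps. pose proof (Rabs_pos K) as HK.
  exists (eps / (Rabs K + 1)). split; [apply Rdiv_lt_0_compat; lra|].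
  intros t [[Ht Hne] Hd]. simpl in Hd |- *. unfold Rdist in *.
  assert (Hts : 0 < Rabs (t - s)) by (apply Rabs_pos_lt; lra).
  apply (Rmult_lt_reg_r (Rabs (t - s))); [exact Hts|].
  rewrite <- Rabs_mult.
  replace (((f t - f s) / (t - s) - F s) * (t - s)) with
    (f t - f s - (t - s) * F s) by (field; lra).
  eapply Rle_lt_trans; [apply H, Ht|].
  rewrite <- (pow2_abs (t - s)).
  apply (Rmult_lt_compat_r (Rabs K + 1)) in Hd; [|lra].
  unfold Rdiv in Hd. rewrite Rmult_assoc, Rinv_l, Rmult_1_r in Hd by lra.
  pose proof (Rle_abs K).
  assert (K * Rabs (t - s) < eps) by nra. nra.
Qed.

(** The limit may be taken separately at each mode and time: the flux involves
    three modes only, and the remainder bound is uniform in the scheme. *)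
Lemma solution_exists (beta E : R) (x : nat -> R) : 0 <= E ->
  (forall N, sum_f_R0 (fun n => start x n ^ 2) N <= E) ->
  exists X, weak_solution beta x X.
Proof.
  intros HE Hx. destruct ultra_exists as [U HU].
  pose proof HU as [HP [HEv _]].
  pose proof (filter_filter' (F := U)) as HF.
  set (X := fun n t => ultralimit U (fun m => approx beta E x m n t)).
  assert (HL : forall n t, 0 <= t ->
    filterlim (fun m => approx beta E x m n t) U (locally (X n t))).
  { intros n t Ht. apply ultralimit_correct with (r := 1 + E); [exact HU|].
    apply HEv. generalize (eventually_above t). apply filter_imp.
    intros m Hm. apply approx_bound; auto.
    destruct (mesh_spec beta E m) as [[Hh _] _].
    pose proof (steps_spec _ t Hh Ht). lra. }
  assert (HU1 : forall (u : nat -> R) c l, filterlim u U (locally l) ->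
     eventually (fun m => u m = c) -> l = c).
  { intros u c l Hu Hc.
    apply (filterlim_locally_unique (F := U) u); [exact Hu|].
    apply (filterlim_ext_loc (fun _ => c)); [|apply filterlim_const].
    apply HEv. revert Hc. apply filter_imp. intros; auto. }
  assert (HX0 : forall t, 0 <= t -> X O t = 0).
  { intros t Ht. apply (HU1 _ _ _ (HL O t Ht)). exists O. intros m _.
    apply euler_0. }
  exists X. split; [exact HX0|].
  intros n Hn. split.
  { apply (HU1 _ _ _ (HL n 0 (Rle_refl 0))). exists n. intros m Hm.
    unfold approx. rewrite steps_0 by apply mesh_spec.
    rewrite euler_start by exact Hm. destruct n; [lia|reflexivity]. }
  intros s Hs. apply D_in_of_taylor with (K := 2 * flux_modulus beta (1 + E) n).
  intros t Ht.
  replace (k beta (n - 1) * X (n - 1)%nat s ^ 2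
           - k beta n * X n s * X (n + 1)%nat s) with
    (flux beta (fun i => X i s) n).
  2: { destruct n as [|p]; [lia|]. unfold flux. simpl Nat.sub.
       rewrite Nat.sub_0_r, Nat.add_1_r. reflexivity. }
  assert (Hg : forall t, 0 <= t ->
    filterlim (fun m => grid_time beta E m t) U (locally t)).
  { intros t' Ht'. apply (filterlim_filter_le_1 (F := eventually)).
    - exact HEv.
    - apply grid_time_lim, Ht'. }
  apply (filterlim_le (F := U)
    (fun m => Rabs (approx beta E x m n t - approx beta E x m n s
        - (grid_time beta E m t - grid_time beta E m s)
          * flux beta (fun i => approx beta E x m i s) n))
    (fun m => 2 * flux_modulus beta (1 + E) n *
      (grid_time beta E m t - grid_time beta E m s) ^ 2)
    (Finite _) (Finite _)).
  - apply HEv.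
    generalize (filter_and _ _ (eventually_above s)
      (filter_and _ _ (eventually_above t)
        (ex_intro _ n (fun m H => H) : eventually (fun m => (n <= m)%nat)))).
    apply filter_imp. intros m [H1 [H2 H3]]. apply approx_taylor; auto; lra.
  - refine (filterlim_comp _ _ _ _ Rabs _ _ _ _
      (filterlim_Rabs (Finite _))).
    simpl Rbar_locally.
    apply filterlim_R_minus; auto.
    + apply filterlim_R_minus; auto.
    + apply filterlim_R_mult; auto.
      * apply filterlim_R_minus; auto.
      * apply (filterlim_flux U HF beta (fun m i => approx beta E x m i s)
          (fun i => X i s)). auto.
  - simpl Rbar_locally. simpl pow. repeat (apply filterlim_R_mult; auto);
      try apply filterlim_const; apply filterlim_R_minus; auto.
Qed.

(** * Weak solutions as flows *)

Lemma rmax_contracts (s t : R) : Rabs (Rmax 0 s - Rmax 0 t) <= Rabs (s - t).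
Proof.
  unfold Rmax; destruct (Rle_dec 0 s), (Rle_dec 0 t);
    apply Rabs_le; split_Rabs; lra.
Qed.

(** Composition with [Rmax 0] freezes the function at negative times, where the
    weak formulation says nothing about it. *)
Lemma evolves_of_D_in (f F : R -> R) :
  (forall t, 0 <= t -> D_in f F (fun s => 0 <= s) t) ->
  evolves (fun t => f (Rmax 0 t)) (fun t => F (Rmax 0 t)).
Proof.
  intros H. split.
  - intros t. apply continuity_pt_filterlim. intros eps Heps.
    destruct (cont_deriv _ _ _ _ (H (Rmax 0 t) (Rmax_l 0 t)) eps Heps)
      as [d [Hd Hf]].
    exists d. split; [exact Hd|]. intros s [_ Hs]. simpl in Hs |- *.
    destruct (Req_dec (Rmax 0 s) (Rmax 0 t)) as [->|Hne].
    + unfold Rdist. rewrite Rminus_diag, Rabs_R0. exact Heps.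
    + apply Hf. split; [split; [apply Rmax_l|auto]|].
      eapply Rle_lt_trans; [apply rmax_contracts|exact Hs].
  - intros t Ht. apply is_derive_Reals. intros eps Heps.
    rewrite (Rmax_right 0 t) by lra.
    destruct (H t ltac:(lra) eps Heps) as [d [Hd Hf]].
    assert (Hm : 0 < Rmin d t) by (apply Rmin_pos; lra).
    exists (mkposreal _ Hm). intros y Hy Hyd. simpl in Hyd.
    pose proof (Rmin_l d t). pose proof (Rmin_r d t).
    assert (0 <= t + y) by (split_Rabs; lra).
    rewrite (Rmax_right 0 (t + y)) by lra.
    specialize (Hf (t + y)). simpl in Hf. unfold Rdist, D_x in Hf.
    replace (t + y - t) with y in Hf by ring.
    apply Hf. repeat split; try lra.
Qed.

Lemma weak_solution_flow (beta : R) (x : nat -> R) (X : nat -> R -> R) :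
  weak_solution beta x X -> flow beta (fun n t => X n (Rmax 0 t)).
Proof.
  intros [H0 HX]. split; [intros; apply H0, Rmax_l|].
  intros [|n].
  - simpl. destruct (evolves_const 0) as [Hc Hd]. split.
    + intros t. apply (continuous_ext (fun _ => 0)); [|apply Hc].
      intros s. symmetry; apply H0, Rmax_l.
    + intros t Ht. apply (is_derive_ext (fun _ => 0)); [|apply Hd, Ht].
      intros s. symmetry; apply H0, Rmax_l.
  - pose proof (evolves_of_D_in _ _ (proj2 (HX (S n) ltac:(lia)))) as M.
    simpl in M. rewrite Nat.sub_0_r, Nat.add_1_r in M. exact M.
Qed.

Lemma l2_start_bound (x : nat -> R) : in_l2 x ->
  exists E, 0 <= E /\ forall N, sum_f_R0 (fun n => start x n ^ 2) N <= E.
Proof.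
  intros [E HE].
  assert (B : forall N, sum_n (fun i => x (S i) ^ 2) N <= E).
  { apply (is_lim_seq_incr_compare _ _ HE). intros N. rewrite sum_Sn.
    change plus with Rplus. pose proof (pow2_ge_0 (x (S (S N)))). lra. }
  assert (HE0 : 0 <= E).
  { eapply Rle_trans; [|apply (B O)]. rewrite sum_O. apply pow2_ge_0. }
  exists E. split; [exact HE0|]. intros [|N]; [simpl; lra|].
  rewrite decomp_sum by lia. simpl pred.
  specialize (B N). rewrite sum_n_Reals in B. simpl in *; lra.
Qed.

Theorem theorem13 (beta : R) (x : nat -> R)
  (hbeta : 1 < beta)
  (hx2 : in_l2 x)
  (hx0 : forall n : nat, (1 <= n)%nat -> 0 <= x n) :
  exists X : nat -> R -> R,
    weak_solution beta x X /\
    forall Y : nat -> R -> R, weak_solution beta x Y ->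
      forall (n : nat) (t : R), (1 <= n)%nat -> 0 <= t -> Y n t = X n t.
Proof.
  destruct (l2_start_bound x hx2) as [E [HE HxE]].
  destruct (solution_exists beta E x HE HxE) as [X HX].
  exists X. split; [exact HX|]. intros Y HY n t _ Ht.
  assert (Hi : forall Z, weak_solution beta x Z ->
    forall n, Z n (Rmax 0 0) = start x n).
  { intros Z [Z0 HZ] m. rewrite Rmax_left by lra.
    destruct m as [|m]; [apply Z0; lra|apply HZ; lia]. }
  rewrite <- (Rmax_right 0 t Ht).
  apply (flow_unique beta (fun n t => X n (Rmax 0 t))
    (fun n t => Y n (Rmax 0 t)) E hbeta
    (weak_solution_flow _ _ _ HX) (weak_solution_flow _ _ _ HY)); [| | |exact Ht].
  - intros m. rewrite (Hi X HX). destruct m; simpl; [lra|apply hx0; lia].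
  - intros m. rewrite (Hi X HX), (Hi Y HY). reflexivity.
  - intros N. unfold energy. rewrite (sum_eq _ (fun n => start x n ^ 2));
      [apply HxE|]. intros m _. rewrite (Hi X HX). reflexivity.
Qed.
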